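(* Let $A(t), B(t), C(t)$ be continuous complex $n\times n$ matrix-valued functions on $[t_0;+\infty)$ with $B(t)=B^*(t)$, $C(t)=C^*(t)$ for $t\ge t_0$, and assume that $\sqrt{B(t)}$ is continuously differentiable on $[t_0;+\infty)$, where: 1') $B(t)\ge0$ for $t\ge t_0$. Suppose moreover that: 9') the matrix equation $$\sqrt{B(t)}A^*(t)-\sqrt{B(t)}'=[\sqrt{B(t)}A^*(t)-\sqrt{B(t)}']\,X\,\sqrt{B(t)}$$ has a continuous solution $X=F(t)$ on $[t_0;+\infty)$ such that $[\sqrt{B(t)}A^*(t)-\sqrt{B(t)}']F(t)$ is continuously differentiable on $[t_0;+\infty)$; 10') the scalar equation $$\phi''+\frac{\operatorname{tr}(\mathcal D_F(t))}{n}\phi=0,\qquad t\ge t_0,$$ is oscillatory, where $$\mathcal D_F(t)=-H_F'(t)-H_F(t)^2-B(t)C(t),$$ $$H_F(t)=\frac{[\sqrt{B(t)}A^*(t)-\sqrt{B(t)}']F(t)+F^*(t)[A(t)\sqrt{B(t)}-\sqrt{B(t)}']}{2}.$$ Then the hamiltonian system $$\Phi'=A(t)\Phi+B(t)\Psi,\qquad \Psi'=C(t)\Phi-A^*(t)\Psi,\qquad t\ge t_0,$$ is also oscillatory.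
   Context: $M^*$ denotes the conjugate transpose of $M$; $H\ge0$ means the hermitian matrix $H$ is non-negative definite; $\sqrt{B(t)}$ is the non-negative definite hermitian square root of $B(t)$ and $\sqrt{B(t)}'$ its derivative in $t$. In the hamiltonian system $\Phi,\Psi$ are unknown continuously differentiable complex $n\times n$ matrix-functions on $[t_0;+\infty)$. A solution $(\Phi,\Psi)$ is called prepared if $\Phi^*(t)\Psi(t)=\Psi^*(t)\Phi(t)$ for $t\ge t_0$. A prepared solution is oscillatory if $\det\Phi(t)$ has arbitrarily large zeroes. The hamiltonian system is oscillatory if every prepared solution is oscillatory. The scalar second-order equation is oscillatory if every (real) solution $\phi$ has arbitrarily large zeroes. *)

(* Defs.v *)
From mathcomp Require Import all_boot all_order all_algebra.
From mathcomp Require Import all_classical all_reals all_analysis.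
From mathcomp Require Import complex.

Set Implicit Arguments.
Unset Strict Implicit.
Unset Printing Implicit Defensive.

Import Order.TTheory GRing.Theory Num.Theory.
Import numFieldNormedType.Exports.

Local Open Scope classical_set_scope.
Local Open Scope complex_scope.
Local Open Scope sesquilinear_scope.
Local Open Scope ring_scope.

(* Functions on [t0, +oo[ are represented by total functions on R of which only
   the values on [t0, +oo[ matter.  Limits of difference quotients are taken
   within [t0, +oo[, so the derivative at t0 is the right derivative and the
   derivative at t > t0 is the usual one. *)

Definition continuous_from (R : realType) (t0 : R) (f : R -> R) : Prop :=
  {within `[t0, +oo[, continuous f}.

Definition derivable_from (R : realType) (t0 : R) (f : R -> R) : Prop :=
  forall t, t0 <= t ->
    cvg ((f s - f t) / (s - t) @[s --> within `[t0, +oo[ t^']).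

Definition deriv_from (R : realType) (t0 : R) (f : R -> R) (t : R) : R :=
  lim ((f s - f t) / (s - t) @[s --> within `[t0, +oo[ t^']).

(* Continuity and differentiation of complex matrix-functions of a real
   variable are those of the real and imaginary parts of the entries. *)

Definition mx_continuous_from (R : realType) (n : nat) (t0 : R)
    (M : R -> 'M[R[i]]_n) : Prop :=
  forall i j, continuous_from t0 (fun t => complex.Re (M t i j)) /\
              continuous_from t0 (fun t => complex.Im (M t i j)).

Definition mx_derivable_from (R : realType) (n : nat) (t0 : R)
    (M : R -> 'M[R[i]]_n) : Prop :=
  forall i j, derivable_from t0 (fun t => complex.Re (M t i j)) /\
              derivable_from t0 (fun t => complex.Im (M t i j)).

Definition mx_deriv_from (R : realType) (n : nat) (t0 : R)
    (M : R -> 'M[R[i]]_n) (t : R) : 'M[R[i]]_n :=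
  \matrix_(i, j) (deriv_from t0 (fun s => complex.Re (M s i j)) t
              +i* deriv_from t0 (fun s => complex.Im (M s i j)) t).

Definition mx_C1_from (R : realType) (n : nat) (t0 : R)
    (M : R -> 'M[R[i]]_n) : Prop :=
  mx_derivable_from t0 M /\ mx_continuous_from t0 (mx_deriv_from t0 M).

(* In the order of R[i], 0 <= z means that z is real and non-negative. *)
Definition nonneg_definite (R : realType) (n : nat) (M : 'M[R[i]]_n) : Prop :=
  M = M ^t* /\ forall x : 'cV[R[i]]_n, 0 <= (x ^t* *m M *m x) 0 0.

(* The non-negative definite hermitian square root; it exists and is unique
   when M is non-negative definite, and the value is irrelevant otherwise. *)
Definition sqrtmx (R : realType) (n : nat) (M : 'M[R[i]]_n) : 'M[R[i]]_n :=
  xget 0 [set S | nonneg_definite S /\ S *m S = M].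

(* sqrt(B) A^* - sqrt(B)' *)
Definition Lmx (R : realType) (n : nat) (t0 : R) (A B : R -> 'M[R[i]]_n)
    (t : R) : 'M[R[i]]_n :=
  sqrtmx (B t) *m (A t) ^t* - mx_deriv_from t0 (fun s => sqrtmx (B s)) t.

Definition Hmx (R : realType) (n : nat) (t0 : R) (A B F : R -> 'M[R[i]]_n)
    (t : R) : 'M[R[i]]_n :=
  2^-1 *: (Lmx t0 A B t *m F t +
           (F t) ^t* *m (A t *m sqrtmx (B t)
                         - mx_deriv_from t0 (fun s => sqrtmx (B s)) t)).

Definition Dmx (R : realType) (n : nat) (t0 : R) (A B C F : R -> 'M[R[i]]_n)
    (t : R) : 'M[R[i]]_n :=
  - mx_deriv_from t0 (Hmx t0 A B F) t
  - Hmx t0 A B F t *m Hmx t0 A B F t - B t *m C t.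

Definition arbitrarily_large_zeros (R : realType) (K : nmodType) (t0 : R)
    (f : R -> K) : Prop :=
  forall T, exists t, [/\ t0 <= t, T <= t & f t = 0].

Definition scalar_solution (R : realType) (t0 : R) (q phi : R -> R) : Prop :=
  [/\ derivable_from t0 phi, derivable_from t0 (deriv_from t0 phi) &
      forall t, t0 <= t -> deriv_from t0 (deriv_from t0 phi) t + q t * phi t = 0].

Definition scalar_oscillatory (R : realType) (t0 : R) (q : R -> R) : Prop :=
  forall phi, scalar_solution t0 q phi -> arbitrarily_large_zeros t0 phi.

Definition hamiltonian_solution (R : realType) (n : nat) (t0 : R)
    (A B C Phi Psi : R -> 'M[R[i]]_n) : Prop :=
  [/\ mx_C1_from t0 Phi, mx_C1_from t0 Psi &
      forall t, t0 <= t ->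
        mx_deriv_from t0 Phi t = A t *m Phi t + B t *m Psi t /\
        mx_deriv_from t0 Psi t = C t *m Phi t - (A t) ^t* *m Psi t].

Definition prepared (R : realType) (n : nat) (t0 : R)
    (Phi Psi : R -> 'M[R[i]]_n) : Prop :=
  forall t, t0 <= t -> (Phi t) ^t* *m Psi t = (Psi t) ^t* *m Phi t.

Definition hamiltonian_oscillatory (R : realType) (n : nat) (t0 : R)
    (A B C : R -> 'M[R[i]]_n) : Prop :=
  forall Phi Psi, hamiltonian_solution t0 A B C Phi Psi ->
    prepared t0 Phi Psi -> arbitrarily_large_zeros t0 (fun t => \det (Phi t)).

(* Main.v *)
(** Suppose that det Phi never vanishes on [T, +oo).  Then Y = Psi Phi^-1 is
    hermitian and solves the matrix Riccati equation
    Y' = C - A^* Y - Y A - Y B Y.  Put S = sqrt B, Z = S Y S and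
    G = (S A^* - S') F, so that S A^* - S' = G S by 9').  Multiplying the
    Riccati equation by S on both sides turns its linear terms into
    - G Z - Z G^*, whence, for V = Z + H_F,
      tr V' = - tr D_F - tr V^2.
    By Cauchy-Schwarz v = tr V / n satisfies v' + v^2 + tr D_F / n <= 0 on
    [T, +oo).  Such a subsolution of the scalar Riccati equation forces the
    solution of phi'' + (tr D_F / n) phi = 0 with phi(T) = 1, phi'(T) = v(T)
    to stay positive on [T, +oo), which contradicts 10'). *)
Require Import Defs.
From mathcomp Require Import all_boot all_order all_algebra.
From mathcomp Require Import all_classical all_reals all_analysis.
From mathcomp Require Import complex.
From mathcomp Require Import ring lra.

Set Implicit Arguments.
Unset Strict Implicit.
Unset Printing Implicit Defensive.

Import Order.TTheory GRing.Theory Num.Theory.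
Import numFieldNormedType.Exports.

Local Open Scope classical_set_scope.
Local Open Scope complex_scope.
Local Open Scope sesquilinear_scope.
Local Open Scope ring_scope.

(** * Second-order linear scalar equations *)

Lemma is_derive_continuous (R : realType) (f : R -> R) (x d : R) :
  is_derive x 1 f d -> {for x, continuous f}.
Proof.
move=> fd; apply/differentiable_continuous/derivable1_diffP.
exact: ex_derive.
Qed.

Section PointwiseRules.
Context (R : realType).
Implicit Types (f g : R -> R) (x a b : R).

Lemma is_derive_addf f g x a b : is_derive x 1 f a -> is_derive x 1 g b ->
  is_derive x 1 (fun y => f y + g y) (a + b).
Proof. exact: is_deriveD. Qed.

Lemma is_derive_oppf f x a : is_derive x 1 f a ->
  is_derive x 1 (fun y => - f y) (- a).
Proof. exact: is_deriveN. Qed.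

Lemma is_derive_subf f g x a b : is_derive x 1 f a -> is_derive x 1 g b ->
  is_derive x 1 (fun y => f y - g y) (a - b).
Proof. exact: is_deriveB. Qed.

Lemma is_derive_mulf f g x a b : is_derive x 1 f a -> is_derive x 1 g b ->
  is_derive x 1 (fun y => f y * g y) (a * g x + f x * b).
Proof.
move=> fa gb; have := is_deriveM fa gb; move=> /is_derive_eq; apply.
by rewrite /GRing.scale/= addrC mulrC.
Qed.

Lemma is_derive_cstf (c x : R) : is_derive x 1 (fun=> c : R) (0 : R).
Proof. exact: is_derive_cst. Qed.

End PointwiseRules.

(** * Primitives of continuous functions *)

Lemma continuous_itv_integrable (R : realType) (f : R -> R) (a b : R) : continuous f ->
  (@lebesgue_measure R).-integrable `[a, b] (EFin \o f).
Proof.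
move=> cf; apply: continuous_compact_integrable; first exact: segment_compact.
exact: continuous_subspaceT.
Qed.

(** The integral [J] runs over ordered intervals and vanishes on empty ones, so [J a x - J x a] is
    the oriented integral from [a] to [x]. *)
Lemma antiderivative (R : realType) (f : R -> R) (a : R) : continuous f ->
  exists2 F : R -> R, F a = 0 & forall x : R, is_derive x 1 F (f x).
Proof.
move=> cf; pose J (u v : R) := (\int[@lebesgue_measure R]_(t in `[u, v]) f t)%R.
exists (fun x => J a x - J x a); first by rewrite subrr.
have intf u v := continuous_itv_integrable u v cf.
have Jsplit c u v : c <= u -> u <= v -> J c v - J c u = J u v.
  move=> cu uv; rewrite /J Rintegral_itvB//.
  rewrite Rintegral_itv_obnd_cbnd//.
  apply: (integrableS _ _ _ (intf u v)) => //.
  by apply: subset_itvr; rewrite bnd_simp.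
have Jrev u v : v < u -> J u v = 0.
  by move=> vu; rewrite /J set_itv_ge ?Rintegral_set0 // bnd_simp -ltNge.
have Jid u : J u u = 0 by rewrite -(Jsplit u u u)// subrr.
(* A common base point strictly below [a] and [x]: near [x] the oriented integral is
   [J c y - J c a], and the fundamental theorem applies at [x], interior to [[c, x + 1]]. *)
move=> x; pose c := - (`|a| + `|x|) - 1.
have ca : c < a
  by rewrite /c; have := ler_norm (- a); rewrite normrN; have := normr_ge0 x; lra.
have cx : c < x
  by rewrite /c; have := ler_norm (- x); rewrite normrN; have := normr_ge0 a; lra.
apply: (near_eq_is_derive (f := fun y => J c y - J c a)).
  near=> y; have cy : c < y by near: y; exact: lt_nbhsr.
  have [ay|ya] := leP a y.
    rewrite (Jsplit c a y) ?(ltW ca)//; case: ltgtP ay => // [ay _|-> _].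
      by rewrite (Jrev y a)// subr0.
    by rewrite Jid subr0.
  by rewrite (Jrev a y)// sub0r -(Jsplit c y a) ?(ltW cy) ?(ltW ya)// opprB.
rewrite -[X in is_derive _ _ _ X]subr0.
apply: is_derive_subf.
have [] := @continuous_FTC1_closed R f c x (x + 1) _ (intf _ _) cx (cf x).
  by rewrite ltrDl.
rewrite derive1E => dJ <-.
exact/derivableP.
Unshelve. all: by end_near. Qed.

(** * Bounds from derivatives and geometrically convergent sequences *)

Lemma derive_ge0_le (R : realType) (f df : R -> R) (a b : R) : a <= b ->
  (forall x, a <= x <= b -> is_derive x 1 f (df x)) ->
  (forall x, a <= x <= b -> 0 <= df x) -> f a <= f b.
Proof.
move=> ab fdf df0; rewrite -subr_ge0.
have [||c cab ->] := @MVT_segment R f df a b ab.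
- by move=> x; rewrite in_itv/= => /andP[/ltW ax /ltW xb]; apply: fdf; rewrite ax.
- apply: derivable_within_continuous => x; rewrite in_itv/= => xab.
  by have := fdf x xab => -[].
- by rewrite mulr_ge0 ?subr_ge0 ?df0.
Qed.

(** Both [g + f] and [g - f] have a non-negative derivative, hence stay non-negative when they start
    so. *)
Lemma derive_dominated (R : realType) (f df g dg : R -> R) (a b : R) :
  (forall x, a <= x <= b -> is_derive x 1 f (df x)) ->
  (forall x, a <= x <= b -> is_derive x 1 g (dg x)) ->
  (forall x, a <= x <= b -> `|df x| <= dg x) ->
  `|f a| <= g a -> forall x, a <= x <= b -> `|f x| <= g x.
Proof.
move=> fdf gdg dfg; rewrite !ler_norml => /andP[f0 g0] x /andP[ax xb].
have sub y : a <= y <= x -> a <= y <= b.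
  by move=> /andP[->] /le_trans; apply.
have h1 : g a + f a <= g x + f x.
  apply: (derive_ge0_le (f := fun y => g y + f y)
    (df := fun y => dg y + df y)) => // y /sub yab.
    by apply: is_derive_addf; [exact: gdg|exact: fdf].
  by have := dfg y yab; rewrite ler_norml; lra.
have h2 : g a - f a <= g x - f x.
  apply: (derive_ge0_le (f := fun y => g y - f y)
    (df := fun y => dg y - df y)) => // y /sub yab.
    by apply: is_derive_subf; [exact: gdg|exact: fdf].
  by have := dfg y yab; rewrite ler_norml; lra.
by rewrite ler_norml; apply/andP; split; lra.
Qed.

Lemma half_expr_small (R : realType) (C e : R) : 0 < e ->
  exists n, C * 2^-1 ^+ n < e.
Proof.
move=> e0; have : C * 2^-1 ^+ n @[n --> \oo] --> 0.
  by apply: (@cvg_geometric R C); rewrite ger0_norm; lra.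
move/cvgr_lt => /(_ _ e0)[N _ hN]; exists N; exact: hN (leqnn N).
Qed.

Lemma le_half_expr_le0 (R : realType) (x C : R) :
  (forall n, x <= C * 2^-1 ^+ n) -> x <= 0.
Proof.
move=> h; rewrite leNgt; apply/negP => /(half_expr_small C)[n].
by rewrite ltNge h.
Qed.

(** The bound is the tail [e n] of the geometric series. Since [e n - e n.+1] is the allowed step,
    [u - e] increases and [u + e] decreases; the supremum of the lower ends of these nested
    intervals is the limit. *)
Lemma geometric_cauchy_lim (R : realType) (u : nat -> R) (E : R) :
  (forall n, `|u n.+1 - u n| <= E * 2^-1 ^+ n) ->
  forall n, `|limn u - u n| <= 2 * E * 2^-1 ^+ n.
Proof.
move=> hu; pose e n := 2 * E * 2^-1 ^+ n.
have eS n : e n.+1 = e n - E * 2^-1 ^+ n by rewrite /e exprS; field.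
have E0 : 0 <= E by have := hu 0; rewrite expr0 mulr1; apply: le_trans.
have e0 n : 0 <= e n by rewrite !mulr_ge0 ?exprn_ge0 ?invr_ge0.
pose v n := u n - e n; pose w n := u n + e n.
have vS : nondecreasing_seq v.
  apply/nondecreasing_seqP => n; rewrite /v eS.
  by have := hu n; rewrite ler_norml; lra.
have wS : nonincreasing_seq w.
  apply/nonincreasing_seqP => n; rewrite /w eS.
  by have := hu n; rewrite ler_norml; lra.
have vw m n : v m <= w n.
  apply: (le_trans (vS _ _ (leq_maxl m n))).
  apply: (le_trans _ (wS _ _ (leq_maxr m n))).
  by rewrite /v /w; have := e0 (maxn m n); lra.
pose l := sup (range v).
have vl n : v n <= l.
  apply: ub_le_sup; last by exists n.
  by exists (w 0) => _ [m _ <-]; exact: vw.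
have lw n : l <= w n.
  by apply: ge_sup; [exists (v 0); exists 0|move=> _ [m _ <-]; exact: vw].
have lu n : `|l - u n| <= e n.
  by have := vl n; have := lw n; rewrite /v /w ler_norml => ? ?; apply/andP; split; lra.
suff -> : limn u = l by [].
apply/cvg_lim => //; apply/cvgrPdist_lt => d d0.
have [N hN] := half_expr_small (2 * E) d0.
exists N => // n /= Nn; apply: le_lt_trans hN; apply: (le_trans (lu n)).
rewrite /e ler_wpM2l ?mulr_ge0//.
by apply: ler_wiXn2l => //; lra.
Qed.

Lemma continuous_segment_bounded (R : realType) (f : R -> R) (a b : R) :
  continuous f -> exists2 M, 0 <= M & forall x, a <= x <= b -> `|f x| <= M.
Proof.
move=> cf; have [ab|ba] := leP a b; last first.
  by exists 0 => // x /andP[ax /(le_trans ax)]; rewrite leNgt ba.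
have [|c _ hc] := @EVT_max R (fun x => `|f x|) a b ab.
  by apply: continuous_subspaceT => x; apply: cvg_norm; exact: cf.
by exists `|f c| => // x xab; apply: hc; rewrite in_itv.
Qed.

Lemma is_derive_expR_affine (R : realType) (c l a x : R) :
  is_derive x 1 (fun t => c * expR (l * (t - a))) (c * (l * expR (l * (x - a)))).
Proof.
have h : is_derive x 1 (fun t : R => l * (t - a)) l.
  have /is_derive_eq := is_derive_mulf (is_derive_cstf l x)
    (is_derive_subf (is_derive_id x 1) (is_derive_cstf a x)).
  by apply; rewrite mul0r add0r subr0 mulr1.
have /is_derive_eq := is_derive_mulf (is_derive_cstf c x)
  (is_derive1_comp (g := fun t => l * (t - a)) (is_derive_expR (l * (x - a))) h).
by apply; rewrite mul0r add0r/=; ring.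
Qed.

(** * Picard iteration for y'' + q y = 0 *)

Section Picard.
Context (R : realType) (t0 : R) (q y0 z0 : R -> R) (P : (R -> R) -> R -> R).
Hypothesis cq : continuous q.
Hypothesis P0 : forall f : R -> R, continuous f -> P f t0 = 0.
Hypothesis PD : forall f : R -> R, continuous f -> forall x : R, is_derive x 1 (P f) (f x).

Let cP (f : R -> R) : continuous f -> continuous (P f).
Proof. by move=> cf x; apply: is_derive_continuous; exact: PD. Qed.

Let cqf (f : R -> R) : continuous f -> continuous (fun x => q x * f x).
Proof. by move=> cf x; apply: cvgM; [exact: cq|exact: cf]. Qed.

(** With [P] the primitive vanishing at [t0], the initial value problem reads y = y0 - T y, where
    [y0] is the affine function carrying the initial data. *)
Let T f := P (P (fun x => q x * f x)).

Let cT (f : R -> R) : continuous f -> continuous (T f).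
Proof. by move=> cf; do 2!apply: cP; exact: cqf. Qed.

(** Domination is integrated twice: [ddG] bounds the integrand, hence [dG] the inner primitive and
    [G] the outer one, both primitives being 0 at [t0]. *)
Let T_dominated (f g G dG ddG : R -> R) (b : R) : continuous f -> continuous g ->
  (forall x, t0 <= x <= b -> is_derive x 1 G (dG x)) ->
  (forall x, t0 <= x <= b -> is_derive x 1 dG (ddG x)) ->
  0 <= G t0 -> 0 <= dG t0 ->
  (forall x, t0 <= x <= b -> `|q x * f x - q x * g x| <= ddG x) ->
  forall x, t0 <= x <= b -> `|T f x - T g x| <= G x.
Proof.
move=> cf cg GdG dGddG G0 dG0 h.
have h1 x : t0 <= x <= b ->
    `|P (fun x => q x * f x) x - P (fun x => q x * g x) x| <= dG x.
  apply: (derive_dominated (f := fun x => P (fun x => q x * f x) x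
    - P (fun x => q x * g x) x) (df := fun x => q x * f x - q x * g x) _ dGddG) => //.
  - by move=> y _; apply: is_derive_subf; apply: PD; exact: cqf.
  - by rewrite !P0 ?subrr ?normr0//; exact: cqf.
apply: (derive_dominated (f := fun x => T f x - T g x)
  (df := fun x => P (fun x => q x * f x) x - P (fun x => q x * g x) x) _ GdG) => //.
- by move=> y _; apply: is_derive_subf; apply: PD; apply: cP; exact: cqf.
- by rewrite /T !P0 ?subrr ?normr0//; apply: cP; exact: cqf.
Qed.

Hypothesis y0z0 : forall x : R, is_derive x 1 y0 (z0 x).
Hypothesis z00 : forall x : R, is_derive x 1 z0 (0 : R).

Let X := fix X n := if n is n.+1 then fun x => y0 x - T (X n) x else y0.

Let cy0 : continuous y0.
Proof. by move=> x; exact: is_derive_continuous (y0z0 x). Qed.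

Let cX n : continuous (X n).
Proof.
elim: n => [|n IH] //= x.
by apply: cvgB; [exact: cy0|exact: cT].
Qed.

(* The weight exp(l (x - t0)) turns the Picard operator into a contraction with
   factor 1/2 on [t0, b]. *)
Let X_cauchy b : exists E, forall n x, t0 <= x <= b ->
  `|X n.+1 x - X n x| <= E * 2^-1 ^+ n.
Proof.
have [M M0 hM] := continuous_segment_bounded t0 b cq.
have [K K0 hK] : exists2 K, 0 <= K &
    forall x, t0 <= x <= b -> `|X 1%N x - X 0%N x| <= K.
  apply: (continuous_segment_bounded t0 b (f := fun x => X 1%N x - X 0%N x)) => x.
  by apply: cvgB; exact: cX.
(* Two integrations of the weight gain a factor 1 / l^2, while [q] costs at most M; this choice
   ensures M <= l^2 / 2, whence the factor 1/2. *)
pose l := 2 * M + 2.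
have l0 : 0 <= l by rewrite /l; lra.
have hn n x : t0 <= x <= b ->
    `|X n.+1 x - X n x| <= K * 2^-1 ^+ n * expR (l * (x - t0)).
  elim: n x => [|n IH] x xb.
    rewrite expr0 mulr1 (le_trans (hK _ xb))// ler_peMr// -expR0 ler_expR.
    by rewrite mulr_ge0// subr_ge0; case/andP: xb.
  have -> : X n.+2 x - X n.+1 x = - (T (X n.+1) x - T (X n) x) by rewrite /=; ring.
  rewrite normrN.
  pose c := K * 2^-1 ^+ n.+1.
  have c0 : 0 <= c by rewrite mulr_ge0// exprn_ge0.
  apply: (T_dominated (b := b) (G := fun t => c * expR (l * (t - t0)))
    (dG := fun t => c * (l * expR (l * (t - t0))))
    (ddG := fun t => c * l * (l * expR (l * (t - t0))))) => //.
  - by move=> y _; exact: is_derive_expR_affine.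
  - move=> y _; have := is_derive_expR_affine (c * l) l t0 y.
    by under eq_fun do rewrite -mulrA.
  - by rewrite mulr_ge0// expR_ge0.
  - by rewrite !mulr_ge0// expR_ge0.
  - move=> y yb; rewrite -mulrBr normrM.
    have e0 := expR_ge0 (l * (y - t0)).
    apply: (le_trans (ler_pM _ _ (hM y yb) (IH y yb))) => //.
    rewrite /c exprS.
    have -> : M * (K * 2^-1 ^+ n * expR (l * (y - t0))) =
      (K * 2^-1 ^+ n * expR (l * (y - t0))) * M by ring.
    have -> : K * (2^-1 * 2^-1 ^+ n) * l * (l * expR (l * (y - t0))) =
      (K * 2^-1 ^+ n * expR (l * (y - t0))) * (2^-1 * l * l) by ring.
    rewrite ler_wpM2l ?mulr_ge0 ?exprn_ge0//.
    by rewrite /l; nra.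
exists (K * expR (l * (b - t0))) => n x xb; rewrite (le_trans (hn n x xb))//.
rewrite -mulrA -[leRHS]mulrA ler_wpM2l// [leRHS]mulrC ler_wpM2l ?exprn_ge0//.
rewrite ler_expR ler_wpM2l// lerD2r.
by case/andP: xb.
Qed.

(** The iterates are controlled only to the right of [t0]; freezing the argument at [t0] makes the
    limit a function continuous on the whole line, to which [P] can be applied. *)
Let Y t := limn (X ^~ (Num.max t t0)).

Let XY b : exists2 E, 0 <= E & forall n x, x <= b ->
  `|Y x - X n (Num.max x t0)| <= E * 2^-1 ^+ n.
Proof.
have [E hE] := X_cauchy (Num.max b t0).
have h n x : x <= b -> `|Y x - X n (Num.max x t0)| <= 2 * E * 2^-1 ^+ n.
  move=> xb; apply: geometric_cauchy_lim => m; apply: hE.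
  by rewrite le_max lexx orbT ge_max !le_max xb lexx orbT.
exists (2 * E) => //.
by have := h 0%N b (lexx b); rewrite expr0 mulr1; apply: le_trans.
Qed.

(** The usual three-epsilon argument, convergence being uniform on all points below [t + 1]. *)
Let continuous_limit : continuous Y.
Proof.
move=> t; apply/cvgrPdist_lt => e e0.
have [E E0 hE] := XY (t + 1).
have [n hn] : exists n, E * 2^-1 ^+ n < e / 3 by apply: half_expr_small; lra.
have cm : {for t, continuous (fun s => X n (Num.max s t0))}.
  apply: (@continuous_comp _ _ _ (fun s => Num.max s t0) (X n)); last exact: cX.
  by apply: (@continuous_max _ _ id (fun=> t0)); [exact: cvg_id|exact: cvg_cst].
have H1 : \forall s \near t, `|X n (Num.max t t0) - X n (Num.max s t0)| < e / 3.
  by move/cvgrPdist_lt : cm; apply; lra.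
have H2 : \forall s \near t, s < t + 1 by apply: lt_nbhsl; rewrite ltrDl.
apply: filterS2 H1 H2 => s h1 st.
have h2 : `|Y t - X n (Num.max t t0)| < e / 3.
  by apply: le_lt_trans hn; apply: hE; lra.
have h3 : `|Y s - X n (Num.max s t0)| < e / 3.
  by apply: le_lt_trans hn; apply: hE; lra.
by move: h1 h2 h3; rewrite !ltr_norml; lra.
Qed.

(** Defining [y] as y0 - T Y makes its derivatives immediate. What remains is y = Y on [t0, +oo),
    obtained by passing to the limit in the recursion for [X]. *)
Lemma picard_solution : exists y z, [/\ y t0 = y0 t0, z t0 = z0 t0,
  forall x : R, is_derive x 1 y (z x) &
  forall x : R, t0 <= x -> is_derive x 1 z (- (q x * y x))].
Proof.
pose y x := y0 x - T Y x; pose z x := z0 x - P (fun x => q x * Y x) x.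
have yY x : t0 <= x -> y x = Y x.
  move=> tx; apply/eqP; rewrite -subr_eq0 -normr_le0.
  have [E E0 hE] := XY x.
  have [M M0 hM] := continuous_segment_bounded t0 x cq.
  pose C := M * E * (2^-1 * (x - t0) ^+ 2) + E.
  apply: (@le_half_expr_le0 _ _ C) => n.
  have XE s : t0 <= s -> Num.max s t0 = s by move=> ts; apply/max_idPl.
  have h1 : `|Y x - X n.+1 x| <= E * 2^-1 ^+ n.
    have := hE n.+1 x (lexx x); rewrite XE// exprS.
    have : 0 <= E * 2^-1 ^+ n by rewrite mulr_ge0// exprn_ge0.
    by move=> ? h; apply: (le_trans h); lra.
  (* [c] bounds q (Y - X n) on [t0, x]; integrating this constant twice gives c (x - t0)^2 / 2. *)
  pose c := M * (E * 2^-1 ^+ n).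
  have c0 : 0 <= c by rewrite !mulr_ge0// exprn_ge0.
  have h2 : `|T Y x - T (X n) x| <= 2^-1 * c * ((x - t0) * (x - t0)).
    apply: (T_dominated (b := x) (G := fun t => 2^-1 * c * ((t - t0) * (t - t0)))
      (dG := fun t => c * (t - t0)) (ddG := fun t => c)) => //.
    - move=> s _; have dt := is_derive_subf (is_derive_id s 1) (is_derive_cstf t0 s).
      have /is_derive_eq := is_derive_mulf (is_derive_cstf (2^-1 * c) s)
        (is_derive_mulf dt dt).
      by apply; field.
    - move=> s _; have dt := is_derive_subf (is_derive_id s 1) (is_derive_cstf t0 s).
      have /is_derive_eq := is_derive_mulf (is_derive_cstf c s) dt.
      by apply; ring.
    - by rewrite subrr !mulr0.
    - by rewrite subrr mulr0.
    - move=> s /andP[ts sx]; rewrite -mulrBr normrM ler_pM//.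
        by apply: hM; rewrite ts.
      by have := hE n s sx; rewrite XE.
    - by rewrite tx lexx.
  rewrite /C mulrDl.
  have -> : y x - Y x = - (T Y x - T (X n) x) - (Y x - X n.+1 x) by rewrite /y /=; ring.
  rewrite (le_trans (ler_normB _ _))// normrN lerD//.
  by rewrite (le_trans h2)// /c expr2 le_eqVlt; apply/orP; left; apply/eqP; ring.
exists y, z; split.
- by rewrite /y /T P0 ?subr0//; apply: cP; exact: cqf.
- by rewrite /z P0 ?subr0//; exact: cqf.
- by move=> x; apply: is_derive_subf; apply: PD; apply: cP; exact: cqf.
- move=> x tx; rewrite yY// -[X in is_derive _ _ _ X]sub0r.
  by apply: is_derive_subf; apply: PD; exact: cqf.
Qed.
End Picard.

Lemma second_order_solution (R : realType) (q : R -> R) (t0 a b : R) :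
  continuous q -> exists y z, [/\ y t0 = a, z t0 = b,
  forall x : R, is_derive x 1 y (z x) &
  forall x : R, t0 <= x -> is_derive x 1 z (- (q x * y x))].
Proof.
move=> cq.
(* Continuity sits inside the existential so that choice yields one primitive operator on all
   functions; for a discontinuous [f] the witness is a dummy. *)
have ex_prim (f : R -> R) : exists F : R -> R, continuous f ->
    F t0 = 0 /\ forall x : R, is_derive x 1 F (f x).
  have [cf|ncf] := pselect (continuous f); last by exists f.
  by have [F F0 FD] := antiderivative t0 cf; exists F.
have [P hP] := choice ex_prim.
have dy0 (x : R) : is_derive x 1 (fun s => a + b * (s - t0)) b.
  have /is_derive_eq := is_derive_addf (is_derive_cstf a x)
    (is_derive_mulf (is_derive_cstf b x)
    (is_derive_subf (is_derive_id x 1) (is_derive_cstf t0 x))).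
  by apply; ring.
have [y [z [yt zt yz zq]]] := picard_solution cq
  (fun f cf => (hP f cf).1) (fun f cf => (hP f cf).2) dy0 (is_derive_cstf b).
by exists y, z; split => //; rewrite yt subrr mulr0 addr0.
Qed.

(** Picard iteration prescribes data at [t0] only. The fundamental pair based at [t0] has constant
    Wronskian 1, so a linear combination of it attains any data at [T]. *)
Lemma second_order_solution_at (R : realType) (q : R -> R) (t0 T a b : R) :
  continuous q -> t0 <= T -> exists y z, [/\ y T = a, z T = b,
  forall x : R, is_derive x 1 y (z x) &
  forall x : R, t0 <= x -> is_derive x 1 z (- (q x * y x))].
Proof.
move=> cq tT.
have [u [u' [ut u't du du']]] := second_order_solution t0 1 0 cq.
have [v [v' [vt v't dv dv']]] := second_order_solution t0 0 1 cq.
have wronskian : u T * v' T - u' T * v T = 1.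
  pose W s := u s * v' s - u' s * v s.
  have WD x : t0 <= x <= T -> is_derive x 1 W 0.
    move=> /andP[tx _].
    have /is_derive_eq := is_derive_subf (is_derive_mulf (du x) (dv' x tx))
      (is_derive_mulf (du' x tx) (dv x)).
    by apply; ring.
  have : W T = W t0.
    apply/eqP; rewrite eq_le; apply/andP; split; last first.
      by apply: (derive_ge0_le (df := fun=> 0)).
    rewrite -lerN2; apply: (derive_ge0_le (f := fun s => - W s) (df := fun=> 0)) => //.
    by move=> x xb; rewrite -oppr0; apply: is_derive_oppf; exact: WD.
  by rewrite /W ut vt u't v't; lra.
(* Cramer's rule for the coefficients, the determinant being the Wronskian 1. *)
pose c := a * v' T - b * v T; pose d := b * u T - a * u' T.
exists (fun s => c * u s + d * v s), (fun s => c * u' s + d * v' s); split.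
- rewrite -[RHS]mulr1 -wronskian /c /d; ring.
- rewrite -[RHS]mulr1 -wronskian /c /d; ring.
- move=> x.
  have /is_derive_eq := is_derive_addf (is_derive_mulf (is_derive_cstf c x) (du x))
    (is_derive_mulf (is_derive_cstf d x) (dv x)).
  by apply; ring.
- move=> x tx.
  have /is_derive_eq := is_derive_addf (is_derive_mulf (is_derive_cstf c x) (du' x tx))
    (is_derive_mulf (is_derive_cstf d x) (dv' x tx)).
  by apply; ring.
Qed.

(** * Riccati subsolutions and positivity of solutions *)

Lemma first_zero (R : realType) (f : R -> R) (a b : R) : continuous f ->
  0 < f a -> a <= b -> f b <= 0 ->
  exists c, [/\ a <= c, f c = 0 & forall x, a <= x <= c -> 0 <= f x].
Proof.
move=> cf fa ab fb.
have ivt r : a <= r -> f r <= 0 -> exists s, [/\ a <= s, s <= r & f s = 0].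
  move=> ar fr; have [||s] := @IVT R f a r 0 ar.
  - exact: continuous_subspaceT.
  - by rewrite ge_min fr orbT le_max (ltW fa).
  - by rewrite in_itv/= => /andP[? ?] ?; exists s.
(* The first zero is the infimum of the zeros beyond [a]: continuity makes it a zero, and a negative
   value before it would, by the intermediate value theorem, produce an earlier zero. *)
pose Z := [set s | a <= s /\ f s = 0].
have Z0 : Z !=set0 by have [s [as_ _ fs]] := ivt b ab fb; exists s.
have Zlb : lbound Z a by move=> s [].
have Zinf : has_inf Z by split => //; exists a.
have ac : a <= inf Z by apply: lb_le_inf.
exists (inf Z); split=> //.
- have [//|fc] := eqVneq (f (inf Z)) 0; exfalso.
  have : \forall s \near inf Z, f s != 0 by exact: (cvgr_neq0 _ (cf (inf Z)) fc).
  move=> /nbhs_ballP[e /= e0 he].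
  have [s Zs sc] := inf_adherent e0 Zinf.
  have cs : inf Z <= s by apply: ge_inf => //; exists a.
  have /he/= : ball (inf Z) e s by rewrite /ball/= ltr_norml; lra.
  by case: Zs => _ ->; rewrite eqxx.
- move=> x /andP[ax xc]; rewrite leNgt; apply/negP => fx.
  have [s [as_ sx fs]] := ivt x ax (ltW fx).
  have : inf Z <= s by apply: ge_inf; [exists a|split].
  move=> cs; have sx' : s = x by apply/eqP; rewrite eq_le sx (le_trans xc cs).
  by move: fx; rewrite -sx' fs ltxx.
Qed.

(* For A' = v, the Riccati inequality makes (y' - v y) e^A nondecreasing as long
   as y >= 0; it vanishes at T, so that y e^(-A) is nondecreasing as well and
   cannot come down from y(T) = 1 to a first zero. *)
Lemma riccati_nonoscillation (R : realType) (q v dv : R -> R) (t0 T : R) :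
  continuous q -> t0 <= T ->
  (forall x, T <= x -> is_derive x 1 v (dv x)) ->
  (forall x, T <= x -> dv x + v x ^+ 2 + q x <= 0) ->
  exists y z, [/\ forall x : R, is_derive x 1 y (z x),
    forall x : R, t0 <= x -> is_derive x 1 z (- (q x * y x)) &
    forall x, T <= x -> 0 < y x].
Proof.
move=> cq tT vdv ric.
have [y [z [yT zT yz zq]]] := second_order_solution_at 1 (v T) cq tT.
exists y, z; split=> // s Ts; rewrite ltNge; apply/negP => ys.
have cy : continuous y by move=> x; exact: is_derive_continuous (yz x).
have y1 : 0 < y T by rewrite yT.
have [c [Tc yc ypos]] := first_zero cy y1 Ts ys.
(* [v] is controlled only on [T, +oo), so it is frozen below [T] before its primitive [A] is
   taken. *)
have cv : continuous (fun x => v (Num.max x T)).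
  move=> x; apply: (@continuous_comp _ _ _ (fun x => Num.max x T) v).
    by apply: (@continuous_max _ _ id (fun=> T)); [exact: cvg_id|exact: cvg_cst].
  by apply: is_derive_continuous (vdv _ _); rewrite le_max lexx orbT.
have [A A0 AD] := antiderivative T cv.
have AD' x : T <= x -> is_derive x 1 A (v x).
  by move=> Tx; have := AD x; rewrite (max_idPl Tx).
have expD x : T <= x -> is_derive x 1 (fun s => expR (A s)) (expR (A x) * v x).
  by move=> Tx; exact: (is_derive1_comp (is_derive_expR (A x)) (AD' x Tx)).
have expND x : T <= x -> is_derive x 1 (fun s => expR (- A s))
    (expR (- A x) * - v x).
  move=> Tx.
  exact: (is_derive1_comp (g := fun s => - A s) (is_derive_expR (- A x))
    (is_derive_oppf (AD' x Tx))).
have g0 r : T <= r <= c -> 0 <= z r - v r * y r.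
  move=> /andP[Tr rc]; rewrite -(pmulr_lge0 _ (expR_gt0 (A r))).
  have -> : 0 = (z T - v T * y T) * expR (A T) by rewrite zT yT mulr1 subrr mul0r.
  (* With z = y' and z' = - q y the terms v z cancel in (z - v y)' + v (z - v y), leaving - (v' +
     v^2 + q) y. *)
  apply: (derive_ge0_le (f := fun r => (z r - v r * y r) * expR (A r))
    (df := fun r => - (dv r + v r ^+ 2 + q r) * y r * expR (A r))) => //.
  - move=> x /andP[Tx xr].
    have /is_derive_eq := is_derive_mulf (is_derive_subf (zq x (le_trans tT Tx))
      (is_derive_mulf (vdv x Tx) (yz x))) (expD x Tx).
    by apply; ring.
  - move=> x /andP[Tx xr]; rewrite !mulr_ge0 ?expR_ge0// ?oppr_ge0 ?ric//.
    by rewrite ypos// Tx (le_trans xr).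
have : y T * expR (- A T) <= y c * expR (- A c).
  apply: (derive_ge0_le (f := fun r => y r * expR (- A r))
    (df := fun r => (z r - v r * y r) * expR (- A r))) => //.
  - move=> x /andP[Tx xr].
    have /is_derive_eq := is_derive_mulf (yz x) (expND x Tx).
    by apply; ring.
  - by move=> x xb; rewrite mulr_ge0 ?expR_ge0 ?g0.
by rewrite yc mul0r yT mul1r leNgt expR_gt0.
Qed.

(** * One-sided and two-sided derivatives *)

Section DerivFrom.
Context (R : realType) (t0 : R).
Implicit Types (f g : R -> R) (t d : R).

Notation right_punctured t := (within `[t0, +oo[ t^').
Notation slope f t := (fun s => (f s - f t) / (s - t)).

Lemma near_right_puncturedP t (P : set R) :
  right_punctured t P <->
  exists2 e, 0 < e & forall s, t0 <= s -> s != t -> `|s - t| < e -> P s.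
Proof.
split.
  move=> /nbhs_ballP[e /= e0 h]; exists e => // s ts st se.
  by apply: (h s) => //; [rewrite /ball/= distrC|rewrite in_itv/= ts].
move=> [e e0 h]; apply/nbhs_ballP; exists e => //= s se st.
by rewrite /= in_itv/= andbT => ts; apply: h => //; rewrite distrC.
Qed.

(** Points just to the right of [t] always remain, even for t = t0; properness makes limits of
    difference quotients unique. *)
Lemma right_punctured_proper t : t0 <= t -> ProperFilter (right_punctured t).
Proof.
move=> tt; apply: Build_ProperFilter_ex => P /near_right_puncturedP[e e0 h].
exists (t + e / 2); apply: h.
- lra.
- by rewrite gt_eqF//; lra.
- by rewrite addrAC subrr add0r ger0_norm; lra.
Qed.

(** Clearing the denominator gives a first-order expansion that also covers s = t. [is_deriveP] has
    the same form, so the one-sided and two-sided notions can be compared directly. *)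
Lemma slope_cvgP f t d :
  slope f t s @[s --> right_punctured t] --> d <->
  forall e, 0 < e -> exists2 a, 0 < a & forall s, t0 <= s -> `|s - t| < a ->
    `|f s - f t - d * (s - t)| <= e * `|s - t|.
Proof.
split.
  move/cvgrPdist_le => h e e0; have /near_right_puncturedP[a a0 ha] := h e e0.
  exists a => // s ts sa; have [->|st] := eqVneq s t.
    by rewrite !subrr mulr0 subrr normr0 mulr0.
  have := ha s ts st sa.
  have st0 : s - t != 0 by rewrite subr_eq0.
  have -> : f s - f t - d * (s - t) = - ((d - slope f t s) * (s - t)) by field.
  by move=> h'; rewrite normrN normrM ler_wpM2r.
move=> h; apply/cvgrPdist_le => e e0; have [a a0 ha] := h e e0.
apply/near_right_puncturedP; exists a => // s ts st sa.
have st0 : s - t != 0 by rewrite subr_eq0.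
rewrite -(ler_pM2r (_ : 0 < `|s - t|)) ?normr_gt0// -normrM.
rewrite -normrN; apply: le_trans (ha s ts sa); rewrite le_eqVlt; apply/orP; left.
by apply/eqP; congr `|_|; field.
Qed.

Lemma is_deriveP f t d : is_derive t 1 f d <->
  forall e, 0 < e -> exists2 a, 0 < a & forall s, `|s - t| < a ->
    `|f s - f t - d * (s - t)| <= e * `|s - t|.
Proof.
have E : is_derive t 1 f d <->
    h^-1 *: (f (h *: (1 : R) + t) - f t) @[h --> 0^'] --> d.
  split=> [[df <-]|h]; first exact: df.
  by apply: DeriveDef; [apply/cvg_ex; exists d|exact: cvg_lim].
split.
  move/E/cvgrPdist_le => h e e0; have /nbhs_ballP[a /= a0 ha] := h e e0.
  exists a => // s sa; have [->|st] := eqVneq s t.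
    by rewrite !subrr mulr0 subrr normr0 mulr0.
  have st0 : s - t != 0 by rewrite subr_eq0.
  have := ha (s - t); rewrite /ball/= sub0r normrN => /(_ sa st0).
  rewrite /GRing.scale/= mulr1 subrK => h'.
  have -> : f s - f t - d * (s - t) = - ((d - (s - t)^-1 * (f s - f t)) * (s - t)).
    by field.
  by rewrite normrN normrM ler_wpM2r.
move=> h; apply/E/cvgrPdist_le => e e0; have [a a0 ha] := h e e0.
apply/nbhs_ballP; exists a => //= u; rewrite /ball/= sub0r normrN => ua u0.
rewrite /GRing.scale/= mulr1 -(ler_pM2r (_ : 0 < `|u|)) ?normr_gt0// -normrM.
have := ha (u + t); rewrite addrK => /(_ ua); apply: le_trans.
rewrite -normrN le_eqVlt; apply/orP; left; apply/eqP; congr `|_|; field.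
exact: u0.
Qed.

Lemma slope_cvg_deriv_from f t d : t0 <= t ->
  slope f t s @[s --> right_punctured t] --> d -> deriv_from t0 f t = d.
Proof.
move=> tt fd; have := right_punctured_proper tt => pf.
exact: cvg_lim.
Qed.

Lemma is_derive_slope_cvg f t d : is_derive t 1 f d ->
  slope f t s @[s --> right_punctured t] --> d.
Proof.
move=> /is_deriveP h; apply/slope_cvgP => e /h[a a0 ha].
by exists a => // s _; exact: ha.
Qed.

Lemma is_derive_deriv_from f t d : t0 <= t -> is_derive t 1 f d ->
  deriv_from t0 f t = d.
Proof. by move=> tt /is_derive_slope_cvg; exact: slope_cvg_deriv_from. Qed.

Lemma derivable_from_is_derive f t : t0 < t -> derivable_from t0 f ->
  is_derive t 1 f (deriv_from t0 f t).
Proof.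
move=> tt df; apply/is_deriveP => e e0.
have /slope_cvgP/(_ e e0)[a a0 ha] := df t (ltW tt).
(* A radius of at most t - t0 keeps the whole neighbourhood inside [t0, +oo). *)
exists (Num.min a (t - t0)); first by rewrite lt_min a0 subr_gt0.
move=> s; rewrite lt_min => /andP[sa st]; apply: ha => //.
by move: st; rewrite ltr_norml; lra.
Qed.

Lemma eq_slope_filter f g t : t0 <= t -> (forall s, t0 <= s -> f s = g s) ->
  slope f t @ right_punctured t = slope g t @ right_punctured t.
Proof.
move=> tt fg; apply/seteqP; split => P /= /near_right_puncturedP[e e0 h];
  apply/near_right_puncturedP; exists e => // s ts st se; have := h s ts st se;
  by rewrite /= !fg.
Qed.

Lemma eq_deriv_from f g t : t0 <= t -> (forall s, t0 <= s -> f s = g s) ->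
  deriv_from t0 f t = deriv_from t0 g t.
Proof. by move=> tt fg; rewrite /deriv_from (eq_slope_filter tt fg). Qed.

Lemma eq_derivable_from f g : (forall s, t0 <= s -> f s = g s) ->
  derivable_from t0 f -> derivable_from t0 g.
Proof.
by move=> fg df t tt; have := df t tt; rewrite (eq_slope_filter tt fg).
Qed.

Lemma deriv_from_opp f t : t0 <= t -> derivable_from t0 f ->
  deriv_from t0 (fun s => - f s) t = - deriv_from t0 f t.
Proof.
move=> tt df; apply: slope_cvg_deriv_from => //; apply/slope_cvgP => e e0.
have /slope_cvgP/(_ e e0)[a a0 ha] := df t tt.
exists a => // s ts sa; apply: le_trans (ha s ts sa).
rewrite -normrN le_eqVlt; apply/orP; left; apply/eqP; congr `|_|; rewrite /deriv_from; ring.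
Qed.

(** Extending [f] to the left of [t0] by the constant [f t0] reduces continuity on the half-line to
    continuity on the line, the setting of the results on scalar equations. *)
Lemma continuous_fromP f :
  continuous_from t0 f <-> continuous (fun t => f (Num.max t t0)).
Proof.
have cmax : continuous (fun t : R => Num.max t t0).
  by move=> t; apply: (@continuous_max _ _ id (fun=> t0)); [exact: cvg_id|exact: cvg_cst].
split=> [/subspace_continuousP cf t|cf].
  have ct : Num.max s t0 @[s --> t] --> within `[t0, +oo[ (nbhs (Num.max t t0)).
    move=> P /= hP.
    have : \forall s \near t, Num.max s t0 \in `[t0, +oo[ -> P (Num.max s t0).
      exact: (cmax t [set s | s \in `[t0, +oo[ -> P s] hP).
    apply: (@filterS _ (nbhs t)) => s; apply.
    by rewrite in_itv/= le_max lexx orbT.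
  apply: (@cvg_comp _ _ _ (fun s => Num.max s t0) f _ _ _ ct).
  by apply: (cf (Num.max t t0)); rewrite /= in_itv/= le_max lexx orbT.
apply/subspace_continuousP => t /=; rewrite in_itv/= andbT => tt.
have := cf t; rewrite /continuous_at (max_idPl tt) => ct.
move=> P /ct hP; have {}hP : \forall s \near t, P (f (Num.max s t0)) := hP.
have : \forall s \near t, s \in `[t0, +oo[ -> P (f s); last by [].
apply: filterS hP => s; rewrite in_itv/= andbT => + ts.
by rewrite (max_idPl ts).
Qed.

Lemma derivable_from_continuous f : derivable_from t0 f -> continuous_from t0 f.
Proof.
move=> df; apply/subspace_continuousP => t /=; rewrite in_itv/= andbT => tt.
have /slope_cvgP/(_ 1 ltr01)[a a0 ha] := df t tt.
set d := lim _ in ha.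
(* The first-order expansion with error 1 makes [K] a Lipschitz constant at [t]. *)
apply/cvgrPdist_lt => e e0; pose K := `|d| + 1.
have K0 : 0 < K by rewrite /K; have := normr_ge0 d; lra.
apply/nbhs_ballP; exists (Num.min a (e / K)) => /=; first by rewrite lt_min a0 divr_gt0.
move=> s; rewrite /ball/= distrC lt_min => /andP[sa se] /[!in_itv]/= /andP[ts _].
rewrite distrC; apply: (@le_lt_trans _ _ (K * `|s - t|)); last first.
  by move: se; rewrite ltr_pdivlMr// mulrC.
have -> : f s - f t = (f s - f t - d * (s - t)) + d * (s - t) by ring.
rewrite (le_trans (ler_normD _ _))// normrM /K.
by have := ha s ts sa; lra.
Qed.

End DerivFrom.

(** * Square roots of non-negative definite matrices *)

Lemma conjmx_mul (C : numClosedFieldType) m n p (M : 'M[C]_(m, n)) (N : 'M[C]_(n, p)) :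
  (M *m N) ^t* = N ^t* *m M ^t*.
Proof. by rewrite trmx_mul map_mxM. Qed.

(** By the spectral theorem M = P^* diag(d) P with [P] unitary and [d] non-negative, so P^*
    diag(sqrt d) P is a square root; its existence validates the choice made by [xget]. *)
Lemma sqrtmx_spec (R : realType) n (M : 'M[R[i]]_n) : nonneg_definite M ->
  nonneg_definite (sqrtmx M) /\ sqrtmx M *m sqrtmx M = M.
Proof.
move=> [Mh Mpos]; apply: (@xgetPex _ 0 [set S | nonneg_definite S /\ S *m S = M]%classic).
have Mn : M \is normalmx by apply/normalmxP; rewrite -Mh.
have [[P d] /= Pu] := orthomx_spectral_subproof Mn.
have PP : P *m P ^t* = 1%:M by exact/unitarymxP.
rewrite invmx_unitary// => ME.
have dpos j : 0 <= d 0 j.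
  (* The quadratic form of [M] at the j-th column of P^* is the eigenvalue d_j. *)
  have := Mpos (P ^t* *m delta_mx j 0).
  rewrite {1}ME conjmx_mul trmxCK !mulmxA !mulmxtVK//.
  have -> : (delta_mx j 0 : 'cV[R[i]]_n) ^t* = delta_mx 0 j.
    by rewrite trmx_delta map_delta_mx.
  by rewrite -rowE -colE !mxE eqxx mulr1n.
pose r := map_mx sqrtC d.
have rC j : Num.conj (r 0 j) = r 0 j by apply: geC0_conj; rewrite mxE sqrtC_ge0.
exists (P ^t* *m diag_mx r *m P); split; [split|].
- have rh : (diag_mx r) ^t* = diag_mx r.
    rewrite tr_diag_mx map_diag_mx; congr diag_mx; apply/rowP => j.
    by rewrite [LHS]mxE; exact: rC.
  by rewrite conjmx_mul conjmx_mul trmxCK rh mulmxA.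
- move=> x; set y := P *m x.
  have -> : x ^t* *m (P ^t* *m diag_mx r *m P) *m x = y ^t* *m diag_mx r *m y.
    by rewrite conjmx_mul !mulmxA.
  rewrite mxE sumr_ge0// => j _; rewrite mul_mx_diag !mxE mulrAC mulr_ge0//.
    by rewrite mulrC mul_conjC_ge0.
  by rewrite sqrtC_ge0.
- have rr : diag_mx r *m diag_mx r = diag_mx d.
    rewrite mulmx_diag; congr diag_mx; apply/rowP => j.
    by rewrite !mxE -expr2 sqrtCK.
  by rewrite -!mulmxA (mulmxA P) PP mul1mx (mulmxA (diag_mx r)) rr [RHS]ME mulmxA.
Qed.

(** * Derivatives of complex matrix functions *)

Section ReIm.
Context (R : realType).
Implicit Types x y : R[i].

Lemma Re_add x y : complex.Re (x + y) = complex.Re x + complex.Re y.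
Proof. by case: x => ? ?; case: y. Qed.

Lemma Im_add x y : complex.Im (x + y) = complex.Im x + complex.Im y.
Proof. by case: x => ? ?; case: y. Qed.

Lemma Re_opp x : complex.Re (- x) = - complex.Re x.
Proof. by case: x. Qed.

Lemma Re_mul x y : complex.Re (x * y) =
  complex.Re x * complex.Re y - complex.Im x * complex.Im y.
Proof. by case: x => ? ?; case: y. Qed.

Lemma Im_mul x y : complex.Im (x * y) =
  complex.Re x * complex.Im y + complex.Im x * complex.Re y.
Proof. by case: x => ? ?; case: y. Qed.

Lemma Re_conjC x : complex.Re (Num.conj x) = complex.Re x.
Proof. by case: x. Qed.

Lemma Im_conjC x : complex.Im (Num.conj x) = - complex.Im x.
Proof. by case: x. Qed.

Lemma Re_bigsum I (r : seq I) (P : pred I) (F : I -> R[i]) :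
  complex.Re (\sum_(i <- r | P i) F i) = \sum_(i <- r | P i) complex.Re (F i).
Proof. exact: (big_morph _ Re_add). Qed.

Lemma ReIm_eq x y :
  complex.Re x = complex.Re y -> complex.Im x = complex.Im y -> x = y.
Proof. by case: x => ? ?; case: y => ? ? /= -> ->. Qed.

Lemma Re_half x : complex.Re (2^-1 * x) = complex.Re x / 2.
Proof.
have E : x = 2^-1 * x + 2^-1 * x by field.
by rewrite [in RHS]E Re_add; field.
Qed.

Lemma Im_half x : complex.Im (2^-1 * x) = complex.Im x / 2.
Proof.
have E : x = 2^-1 * x + 2^-1 * x by field.
by rewrite [in RHS]E Im_add; field.
Qed.

End ReIm.

(** A two-sided derivative, stated as a relation on real and imaginary parts in accordance with the
    entrywise convention for matrix functions. *)
Definition cderive (R : realType) (g : R -> R[i]) (t : R) (d : R[i]) : Prop :=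
  is_derive t 1 (fun s => complex.Re (g s)) (complex.Re d) /\
  is_derive t 1 (fun s => complex.Im (g s)) (complex.Im d).

Definition mxderive (R : realType) m n (M : R -> 'M[R[i]]_(m, n)) (t : R)
    (D : 'M[R[i]]_(m, n)) : Prop :=
  forall i j, cderive (fun s => M s i j) t (D i j).

Section ComplexDerive.
Context (R : realType) (t : R).
Implicit Types (g h : R -> R[i]) (a b : R[i]).

Lemma eq_cderive g h a b : g =1 h -> a = b -> cderive g t a -> cderive h t b.
Proof. by move=> /funext -> ->. Qed.

Lemma cderive_cst a : cderive (fun=> a) t 0.
Proof. by split; exact: is_derive_cstf. Qed.

Lemma cderive_add g h a b : cderive g t a -> cderive h t b ->
  cderive (fun s => g s + h s) t (a + b).
Proof.
move=> [g1 g2] [h1 h2]; rewrite /cderive Re_add Im_add; split.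
  by under eq_fun do rewrite Re_add; exact: is_derive_addf.
by under eq_fun do rewrite Im_add; exact: is_derive_addf.
Qed.

Lemma cderive_mul g h a b : cderive g t a -> cderive h t b ->
  cderive (fun s => g s * h s) t (a * h t + g t * b).
Proof.
move=> [g1 g2] [h1 h2]; split.
  under eq_fun do rewrite Re_mul.
  have /is_derive_eq := is_derive_subf (is_derive_mulf g1 h1) (is_derive_mulf g2 h2).
  by apply; rewrite Re_add !Re_mul; ring.
under eq_fun do rewrite Im_mul.
have /is_derive_eq := is_derive_addf (is_derive_mulf g1 h2) (is_derive_mulf g2 h1).
by apply; rewrite Im_add !Im_mul; ring.
Qed.

Lemma cderive_sum I (r : seq I) (P : pred I) (F : I -> R -> R[i]) (d : I -> R[i]) :
  (forall i, P i -> cderive (F i) t (d i)) ->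
  cderive (fun s => \sum_(i <- r | P i) F i s) t (\sum_(i <- r | P i) d i).
Proof.
move=> Fd; elim: r => [|i r IH].
  by apply: eq_cderive (cderive_cst 0) => [s|]; rewrite big_nil.
case Pi: (P i); last by apply: eq_cderive IH => [s|]; rewrite big_cons Pi.
by apply: eq_cderive (cderive_add (Fd i Pi) IH) => [s|]; rewrite big_cons Pi.
Qed.

Lemma cderive_unique g a b : cderive g t a -> cderive g t b -> a = b.
Proof.
move=> [[_ a1] [_ a2]] [[_ b1] [_ b2]].
by apply: ReIm_eq; [rewrite -a1 -b1|rewrite -a2 -b2].
Qed.

Lemma near_cderive g h a : (\forall s \near t, g s = h s) ->
  cderive g t a -> cderive h t a.
Proof.
move=> gh [g1 g2]; split.
  by apply: near_eq_is_derive g1; apply: filterS gh => s ->.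
by apply: near_eq_is_derive g2; apply: filterS gh => s ->.
Qed.

(** For determinants, adjugates and inverses only existence of the derivative matters; the value
    needed later comes from the product rule and uniqueness. *)
Definition cderivable g := exists d, cderive g t d.

Lemma cderivable_prod I (r : seq I) (P : pred I) (F : I -> R -> R[i]) :
  (forall i, P i -> cderivable (F i)) ->
  cderivable (fun s => \prod_(i <- r | P i) F i s).
Proof.
move=> Fd; elim: r => [|i r [d IH]].
  by exists 0; apply: eq_cderive (cderive_cst 1) => [s|]; rewrite ?big_nil.
case Pi: (P i); last by exists d; apply: eq_cderive IH => [s|]; rewrite ?big_cons ?Pi.
have [a Fa] := Fd i Pi.
by eexists; apply: eq_cderive (cderive_mul Fa IH) => [s|]; rewrite ?big_cons ?Pi.
Qed.

Lemma cderivable_sum I (r : seq I) (P : pred I) (F : I -> R -> R[i]) :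
  (forall i, P i -> cderivable (F i)) ->
  cderivable (fun s => \sum_(i <- r | P i) F i s).
Proof.
move=> Fd; elim: r => [|i r [d IH]].
  by exists 0; apply: eq_cderive (cderive_cst 0) => [s|]; rewrite ?big_nil.
case Pi: (P i); last by exists d; apply: eq_cderive IH => [s|]; rewrite ?big_cons ?Pi.
have [a Fa] := Fd i Pi.
by eexists; apply: eq_cderive (cderive_add Fa IH) => [s|]; rewrite ?big_cons ?Pi.
Qed.

Lemma cderivable_mul g h : cderivable g -> cderivable h ->
  cderivable (fun s => g s * h s).
Proof. by move=> [a ga] [b hb]; eexists; exact: cderive_mul ga hb. Qed.

(** 1 / g is the conjugate of g divided by the real function N = |g|^2. *)
Lemma cderivable_inv g : g t != 0 -> cderivable g -> cderivable (fun s => (g s)^-1).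
Proof.
move=> gt [d [g1 g2]].
pose N s := complex.Re (g s) * complex.Re (g s) + complex.Im (g s) * complex.Im (g s).
have Nt : N t != 0.
  apply: contra_neq gt; rewrite /N; case: (g t) => a b /= /eqP.
  rewrite -!expr2 paddr_eq0 ?sqr_ge0// !sqrf_eq0 => /andP[/eqP -> /eqP ->].
  by [].
have ND : derivable N t 1.
  by have [] := is_derive_addf (is_derive_mulf g1 g1) (is_derive_mulf g2 g2).
have ID := derivableP (derivableV Nt ND).
have [d1 _] := is_derive_mulf g1 ID.
have [d2 _] := is_derive_mulf (is_derive_oppf g2) ID.
eexists (Complex _ _); split => /=; [under eq_fun|under eq_fun].
- move=> s; have -> : complex.Re (g s)^-1 = complex.Re (g s) * (N s)^-1.
    by rewrite /N -!expr2; case: (g s).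
  over.
- exact: derivableP d1.
- move=> s; have -> : complex.Im (g s)^-1 = - complex.Im (g s) * (N s)^-1.
    by rewrite /N -!expr2; case: (g s) => a b /=; rewrite mulNr.
  over.
- exact: derivableP d2.
Qed.

Lemma cderivable_det n (M : R -> 'M[R[i]]_n) :
  (forall i j, cderivable (fun s => M s i j)) -> cderivable (fun s => \det (M s)).
Proof.
move=> Md; apply: cderivable_sum => p _; apply: cderivable_mul.
  by eexists; exact: cderive_cst.
by apply: cderivable_prod.
Qed.

Lemma cderivable_adj n (M : R -> 'M[R[i]]_n) :
  (forall i j, cderivable (fun s => M s i j)) ->
  forall i j, cderivable (fun s => (\adj (M s)) i j).
Proof.
move=> Md i j.
have [d hd] : cderivable (fun s => cofactor (M s) j i).
  apply: cderivable_mul; first by eexists; exact: cderive_cst.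
  apply: cderivable_det => k l.
  have [d hd] := Md (lift j k) (lift i l).
  by exists d; apply: eq_cderive hd => // s; rewrite !mxE.
by exists d; apply: eq_cderive hd => // s; rewrite !mxE.
Qed.

Lemma mxderive_mul m n p (M : R -> 'M[R[i]]_(m, n)) (N : R -> 'M[R[i]]_(n, p)) D E :
  mxderive M t D -> mxderive N t E ->
  mxderive (fun s => M s *m N s) t (D *m N t + M t *m E).
Proof.
move=> MD NE i j.
apply: eq_cderive (cderive_sum (index_enum 'I_n) (P := xpredT)
   (fun k _ => cderive_mul (MD i k) (NE k j))) => [s|]; first by rewrite mxE.
by rewrite !mxE -big_split.
Qed.

Lemma mxderive_unique m n (M : R -> 'M[R[i]]_(m, n)) D E :
  mxderive M t D -> mxderive M t E -> D = E.
Proof.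
move=> MD ME; apply/matrixP => i j.
exact: cderive_unique (MD i j) (ME i j).
Qed.

Lemma near_mxderive m n (M N : R -> 'M[R[i]]_(m, n)) D :
  (\forall s \near t, M s = N s) -> mxderive M t D -> mxderive N t D.
Proof.
move=> MN MD i j; apply: near_cderive (MD i j).
by apply: filterS MN => s ->.
Qed.

(** This is N M^-1 by Cramer's rule, written as a rational expression in the entries so that
    entrywise differentiability is evident. Its derivative is left unspecified. *)
Lemma mxderive_ratio n (M N : R -> 'M[R[i]]_n) D E : \det (M t) != 0 ->
  mxderive M t D -> mxderive N t E ->
  exists G, mxderive (fun s => (\det (M s))^-1 *: (N s *m \adj (M s))) t G.
Proof.
move=> dM MD NE.
have Md i j : cderivable (fun s => M s i j) by exists (D i j).
have h i j : cderivable
    (fun s => ((\det (M s))^-1 *: (N s *m \adj (M s))) i j).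
  have [d hd] : cderivable (fun s => (\det (M s))^-1 *
      (\sum_k N s i k * (\adj (M s)) k j)).
    apply: cderivable_mul; first exact/cderivable_inv/cderivable_det.
    apply: cderivable_sum => k _; apply: cderivable_mul; first by exists (E i k).
    exact: cderivable_adj.
  by exists d; apply: eq_cderive hd => // s; rewrite !mxE.
have [G hG] := choice (fun ij : 'I_n * 'I_n => h ij.1 ij.2).
exists (\matrix_(i, j) G (i, j)) => i j.
by rewrite mxE; exact: (hG (i, j)).
Qed.

Lemma mx_deriv_fromP n t0 (M : R -> 'M[R[i]]_n) : t0 < t ->
  mx_derivable_from t0 M -> mxderive M t (mx_deriv_from t0 M t).
Proof.
by move=> tt dM i j; have [d1 d2] := dM i j; rewrite mxE; split => /=;
  exact: derivable_from_is_derive.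
Qed.

End ComplexDerive.

(** * Traces in the Riccati equation *)

Local Notation retr M := (complex.Re (\tr M)).

Section Trace.
Context (R : realType) (n : nat).
Implicit Types M N : 'M[R[i]]_n.

Lemma retrD M N : retr (M + N) = retr M + retr N.
Proof. by rewrite mxtraceD Re_add. Qed.

Lemma retrN M : retr (- M) = - retr M.
Proof. by rewrite raddfN Re_opp. Qed.

Lemma retr_half M : retr (2^-1 *: M) = retr M / 2.
Proof. by rewrite mxtraceZ Re_half. Qed.

Lemma retr_conj M : retr (M ^t*) = retr M.
Proof. by rewrite !Re_bigsum; apply: eq_bigr => i _; rewrite !mxE Re_conjC. Qed.

Lemma retr_mul M N : retr (M *m N) =
  \sum_i \sum_j (complex.Re (M i j) * complex.Re (N j i)
    - complex.Im (M i j) * complex.Im (N j i)).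
Proof.
rewrite Re_bigsum; apply: eq_bigr => i _; rewrite mxE Re_bigsum.
by apply: eq_bigr => j _; rewrite Re_mul.
Qed.

Lemma conjmx_add M N : (M + N) ^t* = M ^t* + N ^t*.
Proof. by rewrite raddfD /= map_mxD. Qed.

Lemma conjmx_sub M N : (M - N) ^t* = M ^t* - N ^t*.
Proof. by rewrite raddfB /= map_mxB. Qed.

Lemma hermE M i j : M = M ^t* -> M j i = Num.conj (M i j).
Proof. by move=> {1}->; rewrite !mxE. Qed.

(** For hermitian V, tr V^2 is the sum of all |V_ij|^2, hence at least the sum of the squares of the
    real diagonal entries, to which Cauchy-Schwarz applies. *)
Lemma herm_retr_sqr (V : 'M[R[i]]_n) : (0 < n)%N -> V = V ^t* ->
  (retr V / n%:R) ^+ 2 <= retr (V *m V) / n%:R.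
Proof.
move=> n0 Vh; have nR : 0 < n%:R :> R by rewrite ltr0n.
have h1 : \sum_i complex.Re (V i i) ^+ 2 <= retr (V *m V).
  rewrite retr_mul; apply: ler_sum => i _.
  rewrite (bigD1 i)//= -[leLHS]addr0 lerD//.
    rewrite -!expr2; suff -> : complex.Im (V i i) = 0 by rewrite expr0n subr0.
    have := hermE i i Vh; case: (V i i) => a b [/= hb]; lra.
  apply: sumr_ge0 => j _; rewrite (hermE i j Vh) Re_conjC Im_conjC.
  by rewrite mulrN opprK -!expr2 addr_ge0 ?sqr_ge0.
rewrite ler_pdivlMr//; apply: le_trans h1.
(* The mean of the diagonal: the sum of squared deviations from it is non-negative, which is the
   Cauchy-Schwarz inequality needed. *)
pose m := retr V / n%:R.
have : 0 <= \sum_i (complex.Re (V i i) - m) ^+ 2 by apply: sumr_ge0 => i _; exact: sqr_ge0.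
under eq_bigr do rewrite sqrrB.
rewrite big_split/= sumrB sumr_const card_ord.
rewrite sumrMnl -mulr_suml -Re_bigsum -/(\tr V).
have mV : retr V = m * n%:R by rewrite /m divfK// gt_eqF.
rewrite -/m mV -mulr_natr; lra.
Qed.

(** With D = Y' the left side is the derivative of Re tr SYS. From S A^* = G S + S' and its adjoint
    the terms in S' cancel, leaving SCS - Z^2 - (G Z + Z G^* ). The linear terms have the same real
    trace as H Z + Z H, and completing the square gives the right side. *)
Lemma riccati_retr (S S' A C Y G D H Z : 'M[R[i]]_n) :
  S = S ^t* -> S' = S' ^t* -> Y = Y ^t* -> S *m A ^t* - S' = G *m S ->
  D = C - A ^t* *m Y - Y *m A - Y *m (S *m S) *m Y ->
  Z = S *m Y *m S -> H = 2^-1 *: (G + G ^t*) ->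
  retr ((S' *m Y + S *m D) *m S + (S *m Y) *m S') =
  retr (S *m S *m C) + retr (H *m H) - retr ((Z + H) *m (Z + H)).
Proof.
move=> Sh S'h Yh LG DE ZE HE.
have SA : S *m A ^t* = G *m S + S' by rewrite -LG subrK.
have AS : A *m S = S *m G ^t* + S'.
  have := congr1 (fun M => M ^t*) SA.
  by rewrite conjmx_add !conjmx_mul trmxCK -Sh -S'h.
have -> : (S' *m Y + S *m D) *m S + (S *m Y) *m S' =
    S *m C *m S - Z *m Z - (G *m Z + Z *m G ^t*).
  have E : S *m D *m S = S *m C *m S - (G *m S + S') *m Y *m S
      - S *m Y *m (S *m G ^t* + S') - Z *m Z.
    by rewrite -SA -AS DE ZE !mulmxBr !mulmxBl !mulmxA.
  rewrite mulmxDl E !mulmxDl !mulmxDr ZE !mulmxA.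
  by apply/matrixP => i j; rewrite !mxE; ring.
(* Z is hermitian, so G Z is the adjoint of Z G^*, and adjoints share the real part of the trace. *)
have GZ : retr (Z *m G ^t*) = retr (G *m Z).
  by rewrite -retr_conj conjmx_mul trmxCK ZE !conjmx_mul -Sh -Yh !mulmxA.
have HZ : retr (H *m Z) = retr (G *m Z).
  by rewrite HE -scalemxAl retr_half mulmxDl retrD (mxtrace_mulC (G ^t*)) GZ; lra.
have HZ' : retr (Z *m H) = retr (G *m Z) by rewrite mxtrace_mulC.
have SCS : retr (S *m C *m S) = retr (S *m S *m C) by rewrite mxtrace_mulC mulmxA.
rewrite !mulmxDl !mulmxDr !retrD !retrN retrD HZ HZ' GZ SCS.
by ring.
Qed.

End Trace.

(** * Continuity and oscillation on [t0, +oo) *)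

Section ContinuousFrom.
Context (R : realType) (t0 : R).

Lemma eq_continuous_from (f g : R -> R) : (forall t, t0 <= t -> f t = g t) ->
  continuous_from t0 f -> continuous_from t0 g.
Proof.
move=> fg /continuous_fromP cf; apply/continuous_fromP.
suff <- : (fun t => f (Num.max t t0)) = (fun t => g (Num.max t t0)) by [].
by apply/funext => t; apply: fg; rewrite le_max lexx orbT.
Qed.

Lemma continuous_from_add (f g : R -> R) : continuous_from t0 f ->
  continuous_from t0 g -> continuous_from t0 (fun t => f t + g t).
Proof.
move=> /continuous_fromP cf /continuous_fromP cg; apply/continuous_fromP => t.
exact: cvgD (cf t) (cg t).
Qed.

Lemma continuous_from_sub (f g : R -> R) : continuous_from t0 f ->
  continuous_from t0 g -> continuous_from t0 (fun t => f t - g t).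
Proof.
move=> /continuous_fromP cf /continuous_fromP cg; apply/continuous_fromP => t.
exact: cvgB (cf t) (cg t).
Qed.

Lemma continuous_from_mul (f g : R -> R) : continuous_from t0 f ->
  continuous_from t0 g -> continuous_from t0 (fun t => f t * g t).
Proof.
move=> /continuous_fromP cf /continuous_fromP cg; apply/continuous_fromP => t.
exact: cvgM (cf t) (cg t).
Qed.

Lemma continuous_from_cst (c : R) : continuous_from t0 (fun=> c).
Proof. by apply/continuous_fromP => t; exact: cvg_cst. Qed.

Lemma continuous_from_sum I (r : seq I) (F : I -> R -> R) :
  (forall i, continuous_from t0 (F i)) ->
  continuous_from t0 (fun t => \sum_(i <- r) F i t).
Proof.
move=> cF; elim: r => [|i r IH].
  by apply: (eq_continuous_from _ (@continuous_from_cst 0)) => t _; rewrite big_nil.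
apply: (eq_continuous_from _ (continuous_from_add (cF i) IH)) => t _.
by rewrite big_cons.
Qed.

Lemma continuous_from_retr_mul n (M N : R -> 'M[R[i]]_n) :
  mx_continuous_from t0 M -> mx_continuous_from t0 N ->
  continuous_from t0 (fun t => retr (M t *m N t)).
Proof.
move=> cM cN.
apply: (eq_continuous_from (fun t _ => esym (retr_mul (M t) (N t)))).
apply: continuous_from_sum => i; apply: continuous_from_sum => j.
have [m1 m2] := cM i j; have [n1 n2] := cN j i.
by apply: continuous_from_sub; exact: continuous_from_mul.
Qed.

Lemma mx_derivable_from_continuous n (M : R -> 'M[R[i]]_n) :
  mx_derivable_from t0 M -> mx_continuous_from t0 M.
Proof. by move=> dM i j; have [] := dM i j; split; exact: derivable_from_continuous. Qed.

Lemma mx_deriv_from_herm n (M : R -> 'M[R[i]]_n) t : t0 <= t ->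
  mx_derivable_from t0 M -> (forall s, t0 <= s -> M s = (M s) ^t*) ->
  mx_deriv_from t0 M t = (mx_deriv_from t0 M t) ^t*.
Proof.
move=> tt dM Mh; apply/matrixP => i j; rewrite !mxE.
apply: ReIm_eq => /=.
  by apply: eq_deriv_from => // s ts; rewrite (hermE j i (Mh s ts)) Re_conjC.
rewrite -deriv_from_opp//; last by have [] := dM j i.
by apply: eq_deriv_from => // s ts; rewrite (hermE j i (Mh s ts)) Im_conjC.
Qed.

(** Only real parts on the diagonal enter. They agree for H_F and for G = (S A^* - S') F, so tr H_F'
    can be read off from G. *)
Lemma retr_deriv_from n (M N : R -> 'M[R[i]]_n) t : t0 <= t ->
  (forall s i, t0 <= s -> complex.Re (M s i i) = complex.Re (N s i i)) ->
  retr (mx_deriv_from t0 M t) = \sum_i deriv_from t0 (fun s => complex.Re (N s i i)) t.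
Proof.
move=> tt MN; rewrite Re_bigsum; apply: eq_bigr => i _; rewrite mxE /=.
by apply: eq_deriv_from => // s ts; exact: MN.
Qed.

Lemma is_derive_retr n (M : R -> 'M[R[i]]_n) t D : mxderive M t D ->
  is_derive t 1 (fun s => retr (M s)) (retr D).
Proof.
by move=> MD; have [] := cderive_sum (index_enum 'I_n) (P := xpredT) (fun i _ => MD i i).
Qed.

Lemma mx_continuous_from_herm_part n (G H : R -> 'M[R[i]]_n) :
  mx_continuous_from t0 G ->
  (forall t, t0 <= t -> H t = 2^-1 *: (G t + (G t) ^t*)) ->
  mx_continuous_from t0 H.
Proof.
move=> cG HE i j; have [g1 g2] := cG i j; have [g3 g4] := cG j i.
have half := @continuous_from_cst 2^-1.
split.
- apply: (eq_continuous_from _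
    (continuous_from_mul (continuous_from_add g1 g3) half)) => t tt.
  by rewrite HE// !mxE Re_half Re_add Re_conjC.
- apply: (eq_continuous_from _
    (continuous_from_mul (continuous_from_sub g2 g4) half)) => t tt.
  by rewrite HE// !mxE Im_half Im_add Im_conjC.
Qed.

(** Extending [q] as a constant to the left of [t0] gives the setting on the line; the solution that
    is positive on [T, +oo) then violates oscillation. *)
Lemma riccati_scalar_nonoscillatory (q v dv : R -> R) (T : R) :
  continuous_from t0 q -> t0 <= T ->
  (forall x, T <= x -> is_derive x 1 v (dv x)) ->
  (forall x, T <= x -> dv x + v x ^+ 2 + q x <= 0) ->
  ~ scalar_oscillatory t0 q.
Proof.
move=> /continuous_fromP cq tT vdv ric osc.
have [|y [z [yz zq ypos]]] := riccati_nonoscillation cq tT vdv.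
  by move=> x Tx; rewrite (max_idPl (le_trans tT Tx)); exact: ric.
have yE t : t0 <= t -> deriv_from t0 y t = z t.
  by move=> tt; exact: is_derive_deriv_from.
have dz : derivable_from t0 z.
  by move=> t tt; apply/cvg_ex; eexists; exact: is_derive_slope_cvg (zq t tt).
have [|t [_ Tt yt]] := osc y _ T; last by have := ypos t Tt; rewrite yt ltxx.
split.
- by move=> t tt; apply/cvg_ex; eexists; exact: is_derive_slope_cvg (yz t).
- by apply: eq_derivable_from dz => s ts; rewrite yE.
- move=> t tt; rewrite (eq_deriv_from tt yE) (is_derive_deriv_from tt (zq t tt)).
  by rewrite (max_idPl tt) addNr.
Qed.

End ContinuousFrom.

(** * The trace inequality and oscillation of the hamiltonian system *)

Lemma riccati_balance (R : realType) (a h g w m k : R) : m <= w / k ->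
  (a + h - w + g) / k + m + (- g - h - a) / k <= 0.
Proof.
move=> mw; suff -> : (a + h - w + g) / k + m + (- g - h - a) / k = m - w / k.
  by rewrite subr_le0.
by ring.
Qed.

(* In the scalar equation, the trace of Dmx is real because Hmx, B and C are
   hermitian; complex.Re views it as an element of R. *)
Theorem corollary2p3 (R : realType) (n : nat) (hn : (0 < n)%N) (t0 : R)
    (A B C : R -> 'M[R[i]]_n)
    (hA : mx_continuous_from t0 A)
    (hB : mx_continuous_from t0 B)
    (hC : mx_continuous_from t0 C)
    (hBherm : forall t, t0 <= t -> B t = (B t) ^t*)
    (hCherm : forall t, t0 <= t -> C t = (C t) ^t*)
    (hsqrtB : mx_C1_from t0 (fun t => sqrtmx (B t)))
    (h1 : forall t, t0 <= t -> nonneg_definite (B t))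
    (F : R -> 'M[R[i]]_n)
    (hF : mx_continuous_from t0 F)
    (h9 : forall t, t0 <= t ->
       Lmx t0 A B t = Lmx t0 A B t *m F t *m sqrtmx (B t))
    (h9C1 : mx_C1_from t0 (fun t => Lmx t0 A B t *m F t))
    (h10 : scalar_oscillatory t0
       (fun t => complex.Re (\tr (Dmx t0 A B C F t)) / n%:R)) :
  hamiltonian_oscillatory t0 A B C.
Proof.
move=> Phi Psi [dPhi dPsi ham] prep T0; apply: contrapT => nz.
have det0 t : t0 <= t -> T0 <= t -> \det (Phi t) != 0.
  by move=> tt Tt; apply/negP => /eqP d0; apply: nz; exists t.
pose S t := sqrtmx (B t); pose S' := mx_deriv_from t0 S.
pose G t := Lmx t0 A B t *m F t; pose H := Hmx t0 A B F.
have Sh t : t0 <= t -> S t = (S t) ^t*.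
  by move=> /h1/sqrtmx_spec[[]].
have SS t : t0 <= t -> S t *m S t = B t.
  by move=> /h1/sqrtmx_spec[].
have S'h t : t0 <= t -> S' t = (S' t) ^t*.
  by move=> tt; apply: mx_deriv_from_herm => //; case: hsqrtB.
have HE t : t0 <= t -> H t = 2^-1 *: (G t + (G t) ^t*).
  move=> tt; rewrite /H /Hmx /G; congr (_ *: (_ + _)).
  rewrite conjmx_mul; congr (_ *m _).
  by rewrite /Lmx conjmx_sub conjmx_mul trmxCK -(S'h t tt) -(Sh t tt).
have reHG s i : t0 <= s -> complex.Re (H s i i) = complex.Re (G s i i).
  by move=> ts; rewrite HE// !mxE Re_half Re_add Re_conjC; lra.
(* The real part of tr H_F', expressed through [G], whose continuous differentiability is assumed;
   this yields continuity of the scalar coefficient. *)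
pose g t := \sum_i deriv_from t0 (fun s => complex.Re (G s i i)) t.
have qE t : t0 <= t -> (- g t - retr (H t *m H t) - retr (B t *m C t)) / n%:R =
    retr (Dmx t0 A B C F t) / n%:R.
  move=> tt; rewrite /Dmx !retrD !retrN.
  by rewrite (retr_deriv_from (N := G) tt reHG).
have cH : mx_continuous_from t0 H.
  apply: mx_continuous_from_herm_part HE.
  by apply: mx_derivable_from_continuous; case: h9C1.
have cq : continuous_from t0 (fun t => retr (Dmx t0 A B C F t) / n%:R).
  apply: (eq_continuous_from qE); apply: continuous_from_mul.
    2: exact: continuous_from_cst.
  apply: continuous_from_sub; last exact: continuous_from_retr_mul.
  apply: continuous_from_sub; last exact: continuous_from_retr_mul.
  have cg : continuous_from t0 g.
    apply: continuous_from_sum => i; have [_ /(_ i i)[cgi _]] := h9C1.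
    by apply: (eq_continuous_from _ cgi) => t _; rewrite mxE.
  have := continuous_from_sub (@continuous_from_cst _ t0 0) cg.
  by apply: (eq_continuous_from (g := fun t => - g t)) => t _; rewrite sub0r.
(* Psi Phi^-1 in Cramer form, the form in which its differentiability was established. *)
pose Y t := (\det (Phi t))^-1 *: (Psi t *m \adj (Phi t)).
(* The added 1 keeps [T, +oo) strictly beyond [t0] and [T0]: there derivatives are two-sided and Y
   Phi = Psi holds in a neighbourhood of each point. *)
pose T := Num.max t0 T0 + 1.
have tT : t0 < T by rewrite /T ltr_pwDr// le_max lexx.
have T0T : T0 < T by rewrite /T ltr_pwDr// le_max lexx orbT.
have YPhi t : t0 <= t -> T0 <= t -> Y t *m Phi t = Psi t.
  move=> tt Tt; rewrite /Y -scalemxAl -mulmxA mul_adj_mx mul_mx_scalar scalerA.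
  by rewrite mulVf ?scale1r// det0.
have Phi_unit t : t0 <= t -> T0 <= t -> Phi t \in unitmx.
  by move=> tt Tt; rewrite unitmxE unitfE det0.
have Yh t : t0 <= t -> T0 <= t -> Y t = (Y t) ^t*.
  move=> tt Tt; have uP := Phi_unit t tt Tt.
  have uPs : (Phi t) ^t* \in unitmx by rewrite map_unitmx unitmx_tr.
  (* Preparedness becomes Phi^* Y Phi = Phi^* Y^* Phi, and the invertible outer factors cancel. *)
  have := prep t tt; rewrite -(YPhi t tt Tt) conjmx_mul -mulmxA.
  by move=> /(can_inj (mulKmx uPs))/(can_inj (mulmxK uP)).
have YD t : T <= t -> mxderive Y t (C t - (A t) ^t* *m Y t - Y t *m A t
    - Y t *m (S t *m S t) *m Y t).
  move=> Tt; have t0t : t0 < t := lt_le_trans tT Tt.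
  have T0t : T0 < t := lt_le_trans T0T Tt.
  have DPhi := mx_deriv_fromP t0t dPhi.1; have DPsi := mx_deriv_fromP t0t dPsi.1.
  (* Once Y' = D is known to exist, differentiating Y Phi = Psi gives D Phi + Y Phi' = Psi', which
     determines D because Phi is invertible. *)
  have [D hD] := mxderive_ratio (det0 t (ltW t0t) (ltW T0t)) DPhi DPsi.
  suff <- : D = C t - (A t) ^t* *m Y t - Y t *m A t - Y t *m (S t *m S t) *m Y t.
    exact: hD.
  have nearYPhi : \forall s \near t, Y s *m Phi s = Psi s.
    apply: filterS2 (lt_nbhsr t0t) (lt_nbhsr T0t) => s t0s T0s.
    by apply: YPhi; exact: ltW.
  have := mxderive_unique (near_mxderive nearYPhi (mxderive_mul hD DPhi)) DPsi.
  have [-> ->] := ham t (ltW t0t); rewrite -/(Y t) => DE.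
  have YPt := YPhi t (ltW t0t) (ltW T0t).
  apply: (can_inj (mulmxK (Phi_unit t (ltW t0t) (ltW T0t)))).
  rewrite SS ?(ltW t0t)// !mulmxBl -!mulmxA YPt.
  by move/(canRL (addrK _)) : DE => ->; rewrite mulmxDr opprD addrA.
pose Z t := S t *m Y t *m S t.
pose V t := Z t + H t.
(* The mean trace of V, written with [G] in place of [H] so that its derivative comes directly from
   that of [G]. *)
pose v t := (retr (Z t) + retr (G t)) / n%:R.
have vE t : t0 <= t -> v t = retr (V t) / n%:R.
  move=> tt; rewrite /v /V retrD; congr ((_ + _) / _).
  by rewrite !Re_bigsum; apply: eq_bigr => i _; rewrite reHG.
pose dv t := (retr (S t *m S t *m C t) + retr (H t *m H t)
    - retr (V t *m V t) + g t) / n%:R.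
have vdv t : T <= t -> is_derive t 1 v (dv t).
  move=> Tt; have t0t : t0 < t := lt_le_trans tT Tt.
  have T0t := ltW (lt_le_trans T0T Tt).
  have SD := mx_deriv_fromP t0t hsqrtB.1.
  have ZD := is_derive_retr (mxderive_mul (mxderive_mul SD (YD t Tt)) SD).
  have GD := is_derive_retr (mx_deriv_fromP t0t h9C1.1).
  have /is_derive_eq := is_derive_mulf (is_derive_addf ZD GD)
    (is_derive_cstf n%:R^-1 t).
  apply; rewrite mulr0 addr0 /dv; congr ((_ + _) / _).
    2: exact: retr_deriv_from (ltW t0t) _.
  (* Hypothesis 9') in the form S A^* - S' = G S. *)
  have LG : S t *m (A t) ^t* - S' t = G t *m S t by exact: h9 (ltW t0t).
  have := riccati_retr (Sh t (ltW t0t)) (S'h t (ltW t0t))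
    (Yh t (ltW t0t) T0t) LG (erefl _)
    (erefl (Z t)) (HE t (ltW t0t)).
  exact.
apply: (riccati_scalar_nonoscillatory cq (ltW tT) vdv _ h10) => t Tt.
have t0t := le_trans (ltW tT) Tt.
rewrite -qE// vE// /dv SS//.
have Vh : V t = (V t) ^t*.
  rewrite /V conjmx_add; congr (_ + _).
    by rewrite /Z !conjmx_mul -Sh// -Yh// ?mulmxA// (le_trans (ltW T0T)).
  rewrite HE//; apply/matrixP => i j; rewrite !mxE rmorphM rmorphD/= conjCK.
  by rewrite fmorphV rmorph_nat addrC.
(* The terms in tr BC, tr H^2 and [g] cancel between v' and tr D_F / n, leaving v^2 - tr V^2 / n,
   which is at most 0 by Cauchy-Schwarz. *)
exact: riccati_balance (herm_retr_sqr hn Vh).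
Qed.
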